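(* Let $n,k$ be positive integers with $k<\frac n2$ and let $2\leq l\leq k$. Then $$\lambda_l=\sum_{j=0}^{l}(-1)^{l-j}\binom{l}{j}b_{l,j}.$$
   Context: $\mathbb{Z}_n$ is the set of integers modulo $n$ and $\mathbb{Z}_n^{(k)}$ is the set of its $k$-element subsets. For a bijection $\pi:\mathbb{Z}_n\to\mathbb{Z}_n$, let $\mathcal{F}_\pi=\{\{\pi((i-1)k+1),\ldots,\pi(ik)\} : i\in\mathbb{Z}_n\}\subset\mathbb{Z}_n^{(k)}$. An $(n,k)$-wreath is a family of the form $\mathcal{F}_\pi$; $\mathcal{W}_{n,k}$ is the set of all of them. The $(n,k)$-wreath matrix $M$ has rows and columns labelled by $\mathcal{W}_{n,k}$ and entries $M_{\mathcal{F},\mathcal{F}'}=|\mathcal{F}\cap\mathcal{F}'|$. Let $S_n$ be the group of permutations of $\mathbb{Z}_n$. Let $V$ be the complex vector space with basis $\{e_{\mathcal{F}}:\mathcal{F}\in\mathcal{W}_{n,k}\}$ (with the inner product making this basis orthonormal), with $S_n$ acting by $\tau e_{\mathcal{F}_\pi}=e_{\mathcal{F}_{\tau\pi}}$; $M$ acts on $V$. For $T\in\mathbb{Z}_n^{(k)}$ let $w_T=\sum_{\mathcal{F}\ni T}e_{\mathcal{F}}$, and for $A\subseteq\mathbb{Z}_n$ with $|A|\le k$ let $w_A=\sum_{A\subseteq B,\,|B|=k}w_B$. Definition of $\lambda_l$ ($2\le l\le k$): let $V_k$ be the permutation $\mathbb{C}S_n$-module with basis $\{v_T:T\in\mathbb{Z}_n^{(k)}\}$,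 which decomposes as $V_k=\bigoplus_{i=0}^k U_i$ with $U_i$ isomorphic to the Specht module $S^{(n-i,i)}$; let $\Phi:V_k\to V$ be the $\mathbb{C}S_n$-homomorphism with $\Phi(v_T)=w_T$, and let $E_l=\Phi(U_l)$, which for $2\le l\le k$ is isomorphic to $U_l$. The matrix $M$ acts on $E_l$ by multiplication by a scalar, and $\lambda_l$ is this scalar. Definition of $b_{l,j}$ ($2\le l\le k$, $0\le j\le l$): $b_{l,j}=\langle w_{\{1,\dots,l\}},\,w_{\{l-j+1,l-j+2,\ldots,l-j+k\}}\rangle$. By symmetry, $b_{l,j}=\langle w_T,w_A\rangle$ whenever $|A|=l$, $|T|=k$, $|A\cap T|=j$. *)

(* Defs.v *)
From HB Require Import structures.
From mathcomp Require Import all_boot all_order all_fingroup all_algebra.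
From mathcomp Require Export complex.
From mathcomp Require Export reals.
From mathcomp Require classical_sets.

Set Implicit Arguments.
Unset Strict Implicit.
Unset Printing Implicit Defensive.

Import Order.TTheory GRing.Theory Num.Theory.

Local Open Scope ring_scope.

(* Z_n is 'Z_n, which has n elements as soon as n > 1.                        *)

(* {a + 1, ..., a + m} in Z_n *)
Definition segment (n : nat) (a : 'Z_n) (m : nat) : {set 'Z_n} :=
  [set a + (j.+1)%:R | j : 'I_m].

Definition wreath_of (n k : nat) (pi : {perm 'Z_n}) : {set {set 'Z_n}} :=
  [set pi @: segment ((i - 1) * k%:R) k | i : 'Z_n].

Definition wreaths (n k : nat) : {set {set {set 'Z_n}}} :=
  [set wreath_of k pi | pi : {perm 'Z_n}].

Notation wreath n k := {F : {set {set 'Z_n}} | F \in wreaths n k}.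

Notation ksubset n k := {T : {set 'Z_n} | #|T| == k}.

(* The vector space over C with basis indexed by X. *)
Notation freemod C X := {ffun X -> C^o}.

Definition basis_vec (C : fieldType) (X : finType) (x : X) : freemod C X :=
  [ffun y => (y == x)%:R].

Definition lin_ext_fun (C : fieldType) (X : finType) (V : vectType C)
    (g : X -> V) (v : freemod C X) : V :=
  \sum_x (v x : C) *: g x.

Lemma lin_ext_fun_is_linear (C : fieldType) (X : finType) (V : vectType C)
  (g : X -> V) : linear (lin_ext_fun g).
Proof.
move=> a u v; rewrite /lin_ext_fun scaler_sumr -big_split /=.
by apply: eq_bigr => x _; rewrite !ffunE scalerDl scalerA.
Qed.

HB.instance Definition _ (C : fieldType) (X : finType) (V : vectType C)
    (g : X -> V) :=
  GRing.isLinear.Build C (freemod C X) V _ (lin_ext_fun g)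
    (lin_ext_fun_is_linear g).

(* The linear map sending basis_vec x to g x. *)
Definition lin_ext (C : fieldType) (X : finType) (V : vectType C)
    (g : X -> V) : 'Hom(freemod C X, V) := linfun (lin_ext_fun g).

Lemma lin_extE (C : fieldType) (X : finType) (V : vectType C)
  (g : X -> V) (v : freemod C X) : lin_ext g v = \sum_x (v x : C) *: g x.
Proof. by rewrite lfunE. Qed.

Lemma lin_ext_basis (C : fieldType) (X : finType) (V : vectType C)
  (g : X -> V) (x : X) : lin_ext g (basis_vec C x) = g x.
Proof.
rewrite lin_extE (bigD1 x) //= ffunE eqxx scale1r big1 ?addr0 // => y /negPf yx.
by rewrite ffunE yx scale0r.
Qed.

(* Permutation module: tau maps basis_vec x to basis_vec (act tau x). *)
Definition perm_rep (C : fieldType) (G : Type) (X : finType)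
    (act : G -> X -> X) (tau : G) : 'End(freemod C X) :=
  lin_ext (fun x => basis_vec C (act tau x)).

Definition submodule (C : fieldType) (G : Type) (V : vectType C)
    (rho : G -> 'End(V)) (U : {vspace V}) : Prop :=
  forall tau, (rho tau @: U <= U)%VS.

Definition module_iso (C : fieldType) (G : Type) (V V' : vectType C)
    (rho : G -> 'End(V)) (rho' : G -> 'End(V'))
    (U : {vspace V}) (U' : {vspace V'}) : Prop :=
  exists f : 'Hom(V, V'),
    [/\ (f @: U)%VS = U', (U :&: lker f)%VS = 0%VS
      & forall tau v, v \in U -> f (rho tau v) = rho' tau (f v)].

(* A mu-tableau is a bijection t from cells to entries, the cells of the      *)
(* diagram of mu being numbered 0, ..., n - 1 row by row: cell c lies in row  *)
(* reshape_index mu c and column reshape_offset mu c. A tabloid is the family *)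
(* of its rows, as sets of entries. The permutation module below has the      *)
(* tabloids among its basis elements, and the span of the polytabloids is     *)
(* contained in the span of the tabloids.                                     *)
Definition row_family (n : nat) (mu : seq nat) :=
  {ffun 'I_(size mu) -> {set 'Z_n}}.

Definition tabloid (n : nat) (mu : seq nat) (t : {perm 'Z_n}) :
    row_family n mu :=
  [ffun r : 'I_(size mu) =>
     [set t c | c : 'Z_n & reshape_index mu c == r :> nat]].

Definition row_family_act (n : nat) (mu : seq nat) (tau : {perm 'Z_n})
    (R : row_family n mu) : row_family n mu :=
  [ffun r => tau @: R r].

Definition column_stab (n : nat) (mu : seq nat) (t : {perm 'Z_n}) :
    {set {perm 'Z_n}} :=
  [set s : {perm 'Z_n} | [forall c : 'Z_n,
     reshape_offset mu ((t^-1)%g (s (t c))) == reshape_offset mu c]].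

Definition polytabloid (C : fieldType) (n : nat) (mu : seq nat)
    (t : {perm 'Z_n}) : freemod C (row_family n mu) :=
  \sum_(s in column_stab mu t)
     (-1 : C) ^+ s *: basis_vec C (row_family_act s (tabloid mu t)).

Definition Specht (C : fieldType) (n : nat) (mu : seq nat) :
    {vspace freemod C (row_family n mu)} :=
  <<[seq polytabloid C mu t | t : {perm 'Z_n}]>>%VS.

Lemma ksubset_act_proof (n k : nat) (tau : {perm 'Z_n}) (T : ksubset n k) :
  #|tau @: val T| == k.
Proof. by rewrite card_imset ?(valP T) //; exact: perm_inj. Qed.

Definition ksubset_act (n k : nat) (tau : {perm 'Z_n}) (T : ksubset n k) :
    ksubset n k :=
  Sub (tau @: val T) (ksubset_act_proof tau T).

(* U 0, ..., U k are the summands U_i = S^(n-i,i) of V_k; the values of U     *)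
(* beyond k are irrelevant.                                                   *)
Definition Specht_decomposition (C : fieldType) (n k : nat)
    (U : nat -> {vspace freemod C (ksubset n k)}) : Prop :=
  [/\ (\sum_(i < k.+1) U i)%VS = fullv,
      directv (\sum_(i < k.+1) U i)
    & forall i : nat, (i <= k)%N ->
        submodule (perm_rep C (@ksubset_act n k)) (U i) /\
        module_iso (perm_rep C (@ksubset_act n k))
          (perm_rep C (@row_family_act n [:: n - i; i]%N))
          (U i) (Specht C n [:: n - i; i]%N)].

(* w_T = sum of e_F over F containing T, where |T| = k *)
Definition w_ksubset (C : fieldType) (n k : nat) (T : {set 'Z_n}) :
    freemod C (wreath n k) :=
  \sum_(F : wreath n k | T \in val F) basis_vec C F.

(* w_A = sum of w_B over the k-sets B containing A, where |A| <= k; it agrees *)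
(* with w_ksubset when |A| = k.                                               *)
Definition w_subset (C : fieldType) (n k : nat) (A : {set 'Z_n}) :
    freemod C (wreath n k) :=
  \sum_(B : {set 'Z_n} | (A \subset B) && (#|B| == k)) w_ksubset C k B.

Definition wreath_mx (C : fieldType) (n k : nat) (F F' : wreath n k) : C :=
  #|val F :&: val F'|%:R.

(* e_F' is sent to the column of the wreath matrix labelled by F'. *)
Definition wreath_op (C : fieldType) (n k : nat) :
    'End(freemod C (wreath n k)) :=
  lin_ext (fun F' => [ffun F => wreath_mx C F F'] : freemod C (wreath n k)).

Definition Phi (C : fieldType) (n k : nat) :
    'Hom(freemod C (ksubset n k), freemod C (wreath n k)) :=
  lin_ext (fun T : ksubset n k => w_ksubset C k (val T)).

(* The scalar by which f acts on E. The default value 0 is taken when there   *)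
(* is no such scalar, and an arbitrary one is taken when E = 0.               *)
Definition scalar_on (C : fieldType) (V : vectType C) (f : 'End(V))
    (E : {vspace V}) : C :=
  classical_sets.xget 0 (fun c : C => forall v, v \in E -> f v = c *: v).

Definition lambda (C : fieldType) (n k : nat)
    (U : nat -> {vspace freemod C (ksubset n k)}) (l : nat) : C :=
  scalar_on (wreath_op C n k) (Phi C n k @: U l)%VS.

Definition inner (C : numClosedFieldType) (X : finType)
    (u v : freemod C X) : C :=
  \sum_x (u x : C) * (v x : C)^*.

(* For j <= l, as then l - j is not truncated. *)
Definition b_coef (C : numClosedFieldType) (n k l j : nat) : C :=
  inner (w_subset C k (segment (0 : 'Z_n) l))
        (w_ksubset C k (segment ((l - j)%N%:R : 'Z_n) k)).

(* Main.v *)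
Require Import Defs.
From mathcomp Require Import all_boot all_order all_fingroup all_algebra.
From mathcomp Require Import zify ring.
From mathcomp Require classical_sets.

(** Let N = adj Phi o Phi, acting on functions on k-sets.  The entry of N at two
    k-sets counts the wreaths through both, and M = Phi o adj Phi because the
    entry of M at F, F' counts the k-sets common to F and F'.  Hence if
    N u = lam u, then M (Phi u) = lam (Phi u), and everything takes place in
    the permutation module on k-sets.

    Let e be the polytabloid of a tableau of shape (n - l, l), with columns
    {a_i, b_i} for i < l.  The transposition (a_i b_i) negates e, and the
    transpositions of points outside these columns fix it.  The isomorphism of
    U_l with the Specht module is injective on U_l, so the preimage u of e has
    the same two symmetries.  They determine a function on k-sets up to a
    scalar ([pair_alternatingE]): u is a multiple of
      f(T) = prod_i ([a_i in T] - [b_i in T]).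
    As N commutes with permutations, N f has the symmetries too, so
    N f = lam f with lam = (N f)(T0) for any k-set T0 that contains every a_i
    and no b_i, since f(T0) = 1.  Polytabloids span the Specht module, hence
    their preimages span U_l, and M acts on Phi(U_l) through lam.

    Expanding the product over the set J of indices where a_i is chosen gives
      f(T) = sum_J (-1)^(l - |J|) [A_J subset T],
    with A_J the set of the a_i for i in J and the b_i for i not in J.
    Therefore (N f)(T0) = sum_J (-1)^(l - |J|) <w_(A_J), w_T0>, and
    |A_J meet T0| = |J|, so the inner product is b_(l,|J|) and grouping the J
    by size gives the formula ([eigenvalueE], [b_coefE]).

    The scalar is determined only if Phi(U_l) is not 0.  Two of the pairs
    suffice to see this ([Phi_end_pair_neq0]): put {a_0, b_0} and {a_1, b_1}
    across the two ends of one interval I of a wreath.  Any other cyclic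
    interval of length k contains both or neither point of one of these pairs,
    so I is the only member of the wreath at which f is nonzero. *)

Set Implicit Arguments.
Unset Strict Implicit.
Unset Printing Implicit Defensive.

Import Order.TTheory GRing.Theory Num.Theory.
Local Open Scope ring_scope.

(** * Permutations with prescribed values *)

Lemma exists_perm_extending (I X : finType) (p q : I -> X) :
  injective p -> injective q -> exists s : {perm X}, forall i, s (p i) = q i.
Proof.
move=> p_inj q_inj.
suff [s sP]: exists s : {perm X}, forall i, i \in enum I -> s (p i) = q i.
  by exists s => i; apply: sP; rewrite mem_enum.
elim: (enum I) => [|i r [s sP]]; first by exists 1%g.
exists (s * tperm (s (p i)) (q i))%g => j; rewrite inE permM.
have [-> _|ij /= jr] := eqVneq j i; first by rewrite tpermL.
rewrite tpermD; first exact: sP.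
  by rewrite (inj_eq perm_inj) (inj_eq p_inj) eq_sym.
by rewrite sP // (inj_eq q_inj) eq_sym.
Qed.

(** Equal fibre sizes make the two lists of colours permutations of each
    other. *)
Lemma exists_perm_recolor m (K : eqType) (c d : 'I_m -> K) :
  (forall y, #|[set x | c x == y]| = #|[set x | d x == y]|) ->
  exists s : {perm 'I_m}, forall x, d (s x) = c x.
Proof.
move=> card_cd.
have card_count (f : 'I_m -> K) y :
    count_mem y [tuple f x | x < m] = #|[set x | f x == y]|.
  by rewrite /= count_map enumT -size_filter cardsE cardE /enum_mem.
have /tuple_permP [s sP] : perm_eq [tuple c x | x < m] [tuple d x | x < m].
  by apply/allP => y _; rewrite /= !card_count card_cd.
exists s => x; have := congr1 (fun r => tnth r x) (val_inj sP).
by rewrite !tnth_mktuple => ->.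
Qed.

(** The orbit of a pair of sets is determined by the sizes of the four parts
    into which the pair cuts the ground set; this is why b_(l,j) depends on the
    size of the intersection only. *)
Lemma exists_perm_pair m (A T A' T' : {set 'I_m}) :
  #|A| = #|A'| -> #|T| = #|T'| -> #|A :&: T| = #|A' :&: T'| ->
  exists s : {perm 'I_m}, s @: A = A' /\ s @: T = T'.
Proof.
move=> cA cT cI.
have [|s sP] := @exists_perm_recolor m _ (fun x => (x \in A, x \in T))
                  (fun x => (x \in A', x \in T')).
  have cU: #|A :|: T| = #|A' :|: T'| by rewrite !cardsU cA cT cI.
  move=> [b1 b2]; rewrite (_ : [set x | _] =
    (if b1 then A else ~: A) :&: (if b2 then T else ~: T)); last first.
    by apply/setP => x; rewrite !inE xpair_eqE; case: b1 b2 => [] [];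
       rewrite ?inE; case: (x \in A); case: (x \in T).
  rewrite (_ : [set x | _] =
    (if b1 then A' else ~: A') :&: (if b2 then T' else ~: T')); last first.
    by apply/setP => x; rewrite !inE xpair_eqE; case: b1 b2 => [] [];
       rewrite ?inE; case: (x \in A'); case: (x \in T').
  case: b1 b2 => [] [] //.
  - by rewrite -!setDE !cardsD cA cI.
  - rewrite ![~: _ :&: _]setIC -!setDE !cardsD cT.
    by rewrite ![_ :&: A]setIC ![_ :&: A']setIC cI.
  - by rewrite -!setCU [LHS]cardsCs [RHS]cardsCs !setCK cU.
have img (B B' : {set 'I_m}) :
    (forall x, (s x \in B') = (x \in B)) -> s @: B = B'.
  move=> sB; apply/setP => y; rewrite -[y](permKV s) sB.
  by rewrite mem_imset //; exact: perm_inj.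
by exists s; split; apply: img => x; case: (sP x).
Qed.

(** * Counting k-sets in wreaths *)

Lemma mem_segment n (x a : 'Z_n) m : (1 < n)%N -> (m <= n)%N ->
  (x \in segment a m) = ((x - a - 1)%R < m)%N.
Proof.
move=> n_gt1 le_mn; apply/imsetP/idP => [[j _ ->]|lt_m].
  have -> : a + j.+1%:R - a - 1 = j%:R :> 'Z_n by rewrite -natr1; ring.
  by rewrite val_Zp_nat // modn_small // (leq_trans (ltn_ord j)).
exists (Ordinal lt_m) => //.
rewrite -natr1 (_ : _%:R = x - a - 1); last exact: natr_Zp.
by ring.
Qed.

Lemma card_segment n (a : 'Z_n) m : (1 < n)%N -> (m <= n)%N ->
  #|segment a m| = m.
Proof.
move=> n_gt1 le_mn; rewrite card_imset ?card_ord // => i j /addrI /eqP.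
rewrite -!natr1 (inj_eq (addIr 1)) => /eqP /(congr1 (@nat_of_ord _)).
rewrite !val_Zp_nat // !modn_small => [/val_inj //||];
by apply: leq_trans le_mn.
Qed.

Lemma card_mem_wreath n k (F : wreath n k) (T : {set 'Z_n}) :
  (1 < n)%N -> (k <= n)%N ->
  T \in val F -> #|T| = k.
Proof.
move=> n_gt1 le_kn; case: F => F /= /imsetP[pi _ ->] /imsetP[i _ ->].
by rewrite card_imset ?card_segment //; exact: perm_inj.
Qed.

Lemma wreath_act_proof n k (s : {perm 'Z_n}) (F : wreath n k) :
  [set s @: (T : {set 'Z_n}) | T in val F] \in wreaths n k.
Proof.
case: F => F /= /imsetP[pi _ ->]; apply/imsetP; exists (pi * s)%g => //.
rewrite /wreath_of -imset_comp; apply: eq_imset => i /=.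
by rewrite -imset_comp; apply: eq_imset => x; rewrite /= permM.
Qed.

Definition wreath_act n k (s : {perm 'Z_n}) (F : wreath n k) : wreath n k :=
  Sub [set s @: (T : {set 'Z_n}) | T in val F] (wreath_act_proof s F).

Lemma imset_perm_inj (X : finType) (s : {perm X}) :
  injective (fun T : {set X} => s @: T).
Proof. exact: imset_inj (@perm_inj _ s). Qed.

Lemma wreath_act_inj n k s : injective (@wreath_act n k s).
Proof.
move=> F G /(congr1 val) /= /(imset_inj (@imset_perm_inj _ s)) FG.
exact: val_inj.
Qed.

Lemma mem_wreath_act n k (s : {perm 'Z_n}) (F : wreath n k) (T : {set 'Z_n}) :
  (s @: T \in val (wreath_act s F)) = (T \in val F).
Proof. exact/mem_imset/imset_perm_inj. Qed.

Lemma ksubset_actK n k (s : {perm 'Z_n}) :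
  cancel (@ksubset_act n k s) (ksubset_act s^-1).
Proof.
move=> T; apply: val_inj; rewrite /= -imset_comp -[RHS]imset_id.
by apply: eq_imset => x; rewrite /= permK.
Qed.

Lemma ksubset_actKV n k (s : {perm 'Z_n}) :
  cancel (@ksubset_act n k s^-1) (ksubset_act s).
Proof. by rewrite -{2}[s]invgK; exact: ksubset_actK. Qed.

Lemma ksubset_act_inj n k s : injective (@ksubset_act n k s).
Proof. exact: can_inj (ksubset_actK s). Qed.

(** * The wreath operator as a composition *)

Section Eigenvalue.

Variable C : numClosedFieldType.

Lemma basis_vecE (X : finType) (x y : X) : basis_vec C x y = (y == x)%:R.
Proof. by rewrite ffunE. Qed.

Lemma lin_ext_basis_actE (X Y : finType) (g : X -> Y) (v : freemod C X) y :
  lin_ext (fun x => basis_vec C (g x)) v y = \sum_(x | g x == y) v x.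
Proof.
rewrite lin_extE sum_ffunE [RHS]big_mkcond; apply: eq_bigr => x _.
by rewrite !ffunE eq_sym; case: eqP => _; [exact: mulr1 | exact: mulr0].
Qed.

Lemma perm_repE n k s (u : freemod C (ksubset n k)) T :
  perm_rep C (@ksubset_act n k) s u T = u (ksubset_act s^-1 T).
Proof.
rewrite lin_ext_basis_actE (big_pred1 (ksubset_act s^-1 T)) // => S.
exact: (can2_eq (ksubset_actK s) (@ksubset_actKV n k s)).
Qed.

Lemma w_ksubsetE n k (T : {set 'Z_n}) (F : wreath n k) :
  w_ksubset C k T F = (T \in val F)%:R.
Proof.
rewrite sum_ffunE big_mkcond (bigD1 F) //= big1 => [|G /negPf GF]; last first.
  by rewrite basis_vecE eq_sym GF if_same.
by rewrite basis_vecE eqxx addr0; case: ifP.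
Qed.

Lemma w_subsetE n k (A : {set 'Z_n}) (F : wreath n k) :
  w_subset C k A F =
  \sum_(B : {set 'Z_n} | (A \subset B) && (#|B| == k)) (B \in val F)%:R.
Proof. by rewrite sum_ffunE; apply: eq_bigr => B _; exact: w_ksubsetE. Qed.

Lemma PhiE n k (u : freemod C (ksubset n k)) (F : wreath n k) :
  Phi C n k u F = \sum_(T : ksubset n k | val T \in val F) u T.
Proof.
rewrite lin_extE sum_ffunE [RHS]big_mkcond; apply: eq_bigr => T _.
by rewrite ffunE w_ksubsetE; case: ifP => _; [exact: mulr1 | exact: mulr0].
Qed.

Definition Phi_adj n k (v : freemod C (wreath n k)) : freemod C (ksubset n k) :=
  [ffun T => \sum_(F : wreath n k | val T \in val F) (v F : C)].

(** M = Phi o adj Phi: the k-sets counted by the entry at F, F' are the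
    indices of the inner sum. *)
Lemma wreath_opE n k (v : freemod C (wreath n k)) :
  (1 < n)%N -> (k <= n)%N -> wreath_op C n k v = Phi C n k (Phi_adj v).
Proof.
move=> n_gt1 le_kn; apply/ffunP => F.
rewrite lin_extE sum_ffunE PhiE.
under [RHS]eq_bigr do rewrite ffunE big_mkcond.
rewrite exchange_big; apply: eq_bigr => F' _ /=.
rewrite !ffunE -big_mkcondr sumr_const /=.
rewrite (_ : _ *: _ = v F' *+ #|val F :&: val F'|); last exact: mulr_natr.
congr (_ *+ _); rewrite -[RHS]cardsE -[RHS](card_imset _ val_inj).
apply: eq_card => T; apply/setIP/imsetP => [[TF TF']|[S]].
  have cT : #|T| == k by rewrite (card_mem_wreath n_gt1 le_kn TF).
  by exists (Sub T cT); rewrite // inE; apply/andP.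
by rewrite inE => /andP[SF SF'] ->.
Qed.

(** Phi_adj o Phi commutes with permutations because they
    permute the wreaths. *)
Lemma Phi_adj_Phi_equivariant n k (s : {perm 'Z_n})
    (u : freemod C (ksubset n k)) T :
  Phi_adj (Phi C n k u) (ksubset_act s T) =
  Phi_adj (Phi C n k [ffun S => u (ksubset_act s S)]) T.
Proof.
rewrite !ffunE (reindex_inj (@wreath_act_inj n k s)) /=.
apply: eq_big => [F|F _]; first exact: mem_wreath_act.
rewrite !PhiE (reindex_inj (@ksubset_act_inj n k s)) /=.
apply: eq_big => [S|S _]; first exact: mem_wreath_act.
by rewrite ffunE.
Qed.

Lemma Phi_adjZ n k a (v : freemod C (wreath n k)) :
  Phi_adj (a *: v) = a *: Phi_adj v.
Proof.
apply/ffunP => T; rewrite !ffunE scaler_sumr; apply: eq_bigr => F _.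
by rewrite ffunE.
Qed.

(** * Alternating functions on k-sets *)

Section Alternating.

Variables n k l : nat.
Variable p : 'I_l * bool -> 'Z_n.

(** The symmetries of a polytabloid whose columns of length 2 are the pairs
    p (i, true), p (i, false). *)
Definition pair_alternating (u : freemod C (ksubset n k)) :=
  (forall i T, u (ksubset_act (tperm (p (i, true)) (p (i, false))) T) = - u T)
  /\ (forall x y, x \notin codom p -> y \notin codom p ->
      forall T, u (ksubset_act (tperm x y) T) = u T).

Definition pair_product : freemod C (ksubset n k) :=
  [ffun T : ksubset n k => \prod_(i < l)
     ((p (i, true) \in val T)%:R - (p (i, false) \in val T)%:R) : C^o].

Hypothesis p_inj : injective p.

Lemma mem_ksubset_tperm x y z (T : ksubset n k) :
  (z \in val (ksubset_act (tperm x y) T)) = (tperm x y z \in val T).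
Proof.
rewrite /= -[z in LHS](tpermK x y) mem_imset //; exact: perm_inj.
Qed.

Lemma pair_product_alternating : pair_alternating pair_product.
Proof.
split=> [i T|x y xp yp T]; rewrite !ffunE; last first.
  have neq z q : z \notin codom p -> z != p q.
    by apply: contraNneq => ->; exact: codom_f.
  by apply: eq_bigr => i _; rewrite !mem_ksubset_tperm !tpermD ?neq.
rewrite (bigD1 i) // [in RHS](bigD1 i) //= -mulNr opprB.
rewrite !mem_ksubset_tperm tpermL tpermR; congr (_ * _).
apply: eq_bigr => j ji; rewrite !mem_ksubset_tperm !tpermD // (inj_eq p_inj);
by rewrite xpair_eqE eq_sym (negPf ji).
Qed.

Lemma pair_product_eq0 (T : ksubset n k) i :
  (p (i, true) \in val T) = (p (i, false) \in val T) -> pair_product T = 0.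
Proof. by move=> Ti; rewrite ffunE (bigD1 i) //= Ti subrr mul0r. Qed.

Variable T0 : ksubset n k.
Hypothesis T0_true : forall i, p (i, true) \in val T0.
Hypothesis T0_false : forall i, p (i, false) \notin val T0.

Lemma pair_product_base : pair_product T0 = 1.
Proof.
rewrite ffunE big1 // => i _.
by rewrite T0_true (negPf (T0_false i)) subr0.
Qed.

Lemma pair_alternating_eq0 u (T : ksubset n k) i : pair_alternating u ->
  (p (i, true) \in val T) = (p (i, false) \in val T) -> u T = 0.
Proof.
case=> u_alt _ Ti; have := u_alt i T.
rewrite (_ : ksubset_act _ T = T) => [/eqP|].
  by rewrite -addr_eq0 -mulr2n mulrn_eq0 /= => /eqP.
apply: val_inj; apply/setP => z; rewrite mem_ksubset_tperm.
by case: tpermP => // ->.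
Qed.

(** If some pair has both or neither point in T, the transposition of that pair
    fixes T and negates u, so u and the product both vanish at T.  Otherwise a
    transposition brings T closer to T0: that of a pair whose false point lies
    in T if there is one, and that of two points outside the pairs if not.  It
    acts in the same way on u and on the product. *)
Lemma pair_alternatingE u : pair_alternating u -> u = u T0 *: pair_product.
Proof.
move=> u_alt; apply/ffunP => T; rewrite [RHS]ffunE.
have f_alt := pair_product_alternating.
have [m] := ubnP #|val T :\: val T0|; elim: m T => // m IHm T le_m.
have [/existsP[i /eqP Ti]|/existsPn balanced] :=
    boolP [exists i, (p (i, true) \in val T) == (p (i, false) \in val T)].
  by rewrite (pair_alternating_eq0 u_alt Ti) (pair_product_eq0 Ti) scaler0.
have step x y : x \in val T -> x \notin val T0 -> y \notin val T ->
    y \in val T0 ->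
    (#|val (ksubset_act (tperm x y) T) :\: val T0| < m)%N.
  move=> xT xT0 yT yT0; rewrite ltnS in le_m; apply: leq_trans le_m.
  apply: proper_card; apply/properP; split.
    apply/subsetP => z; rewrite !inE mem_ksubset_tperm => /andP[zT0].
    case: tpermP => [_|zy|_ _ ->]; first by rewrite (negPf yT).
      by rewrite zy yT0 in zT0.
    by rewrite zT0.
  by exists x; rewrite !inE ?mem_ksubset_tperm ?tpermL ?xT ?xT0 ?(negPf yT)
    ?andbF.
have [/existsP[i bT]|/existsPn bT] := boolP [exists i, p (i, false) \in val T].
  have aT : p (i, true) \notin val T.
    by move: (balanced i); rewrite bT; case: (_ \in _).
  apply: oppr_inj; rewrite -(u_alt.1 i) tpermC IHm; last exact: step.
  by rewrite tpermC (f_alt.1 i) -[RHS]scalerN.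
have aT i : p (i, true) \in val T.
  by move: (balanced i); rewrite (negPf (bT i)); case: (_ \in _).
have [/eqP TT0|] := eqVneq (val T :\: val T0) set0.
  suff -> : T = T0 by rewrite pair_product_base; exact/esym/mulr1.
  apply/val_inj/eqP; rewrite eqEcard -setD_eq0 TT0.
  by rewrite (eqP (valP T)) (eqP (valP T0)) leqnn.
move=> TT0; case/set0Pn: (TT0) => x; rewrite inE => /andP[xT0 xT].
have /set0Pn[y] : val T0 :\: val T != set0.
  rewrite -card_gt0; move: TT0; rewrite -card_gt0 !cardsD setIC.
  by rewrite (eqP (valP T0)) (eqP (valP T)).
rewrite inE => /andP[yT yT0].
have xp : x \notin codom p.
  by apply/codomP => -[[i []] xE]; [move: xT0 (T0_true i) | move: (bT i) xT];
     rewrite xE => /negP.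
have yp : y \notin codom p.
  by apply/codomP => -[[i []] yE]; [move: yT (aT i) | move: (T0_false i) yT0];
     rewrite yE => /negP.
rewrite -(u_alt.2 _ _ xp yp T) -(f_alt.2 _ _ xp yp T) IHm //; exact: step.
Qed.


Lemma Phi_adj_Phi_alternating u :
  pair_alternating u -> pair_alternating (Phi_adj (Phi C n k u)).
Proof.
case=> u_alt u_inv; split=> [i T|x y xp yp T].
  rewrite Phi_adj_Phi_equivariant.
  set v := finfun _; have -> : v = (-1) *: u.
    by apply/ffunP => S; rewrite !ffunE u_alt [RHS]mulN1r.
  by rewrite linearZ Phi_adjZ scaleN1r ffunE.
rewrite Phi_adj_Phi_equivariant.
set v := finfun _; have -> // : v = u.
by apply/ffunP => S; rewrite !ffunE u_inv.
Qed.

(** Alternating functions form a line that Phi_adj o Phi preserves, so its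
    eigenvalue there can be read off at T0, where the product is 1. *)
Lemma wreath_op_Phi_alternating u : (1 < n)%N -> (k <= n)%N ->
  pair_alternating u ->
  wreath_op C n k (Phi C n k u) =
  Phi_adj (Phi C n k pair_product) T0 *: Phi C n k u.
Proof.
move=> n_gt1 le_kn u_alt; rewrite wreath_opE // -linearZ; congr (Phi _ _ _ _).
have f_alt := Phi_adj_Phi_alternating pair_product_alternating.
rewrite (pair_alternatingE u_alt) linearZ Phi_adjZ {1}(pair_alternatingE f_alt).
by rewrite !scalerA mulrC.
Qed.

End Alternating.

(** * The eigenvalue in terms of inner products *)

Lemma inner_w n k (A T : {set 'Z_n}) :
  inner (w_subset C k A) (w_ksubset C k T) =
  \sum_(F : wreath n k | T \in val F)
    \sum_(S : ksubset n k | val S \in val F) (A \subset val S)%:R.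
Proof.
rewrite [RHS]big_mkcond; apply: eq_bigr => F _.
rewrite w_ksubsetE w_subsetE rmorph_nat.
case: ifP => _; rewrite ?mulr0 ?mulr1 //.
transitivity (\sum_(B : {set 'Z_n} | (#|B| == k) && (B \in val F))
                (A \subset B)%:R : C); last first.
  exact: (big_sub_cond (fun B : {set 'Z_n} => #|B| == k)
            (fun B => B \in val F)).
rewrite big_mkcond [RHS]big_mkcond; apply: eq_bigr => B _.
by case: (A \subset B); case: (_ == k); case: (B \in _).
Qed.

Lemma inner_w_act n k (s : {perm 'Z_n}) (A T : {set 'Z_n}) :
  inner (w_subset C k (s @: A)) (w_ksubset C k (s @: T)) =
  inner (w_subset C k A) (w_ksubset C k T).
Proof.
rewrite !inner_w (reindex_inj (@wreath_act_inj n k s)) /=.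
apply: eq_big => [F|F _]; first exact: mem_wreath_act.
rewrite (reindex_inj (@ksubset_act_inj n k s)) /=.
apply: eq_big => [S|S _]; first exact: mem_wreath_act.
congr (_%:R : C); congr (nat_of_bool _); apply/idP/idP; last exact: imsetS.
move=> /subsetP sAS; apply/subsetP => x xA.
rewrite -(mem_imset _ _ (@perm_inj _ s)) sAS // mem_imset //.
exact: perm_inj.
Qed.

Lemma lt_Zn n (x : 'Z_n) : (1 < n)%N -> (x < n)%N.
Proof. by move=> n_gt1; rewrite -[n in (_ < n)%N]Zp_cast. Qed.

Lemma val_ZnB n (x : 'Z_n) c : (1 < n)%N -> (c < n)%N ->
  (x - c%:R)%R = (if (c <= x)%N then x - c else n + x - c)%N :> nat.
Proof.
move=> n_gt1 lt_cn; have lt_xn := lt_Zn x n_gt1.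
have -> : x - c%:R = (n + x - c)%:R :> 'Z_n.
  rewrite natrB; last by rewrite ltnW // ltn_addr.
  by rewrite natrD natr_Zp pchar_Zp // add0r.
rewrite val_Zp_nat //; move: (nat_of_ord x) lt_xn => y lt_yn.
case: leqP => le_cy.
  by rewrite -addnBA // modnDl modn_small // (leq_ltn_trans (leq_subr _ _)).
by rewrite modn_small //; lia.
Qed.

Lemma segmentI n k l j :
  (1 < n)%N -> (l < n)%N -> (l + k <= n)%N -> (j <= l)%N -> (j <= k)%N ->
  segment (0 : 'Z_n) l :&: segment ((l - j)%N%:R : 'Z_n) k
  = segment ((l - j)%N%:R : 'Z_n) j.
Proof.
move=> n_gt1 lt_ln le_lkn le_jl le_jk; apply/setP => x.
rewrite !inE !mem_segment //; try lia.
rewrite subr0 addrAC val_ZnB //; last by lia.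
set y : 'Z_n := x - 1; have lt_yn := lt_Zn y n_gt1.
by move: (nat_of_ord y) lt_yn => z lt_zn; case: (leqP (l - j) z) => le_z; lia.
Qed.

Lemma b_coefE n k l j (A T : {set 'Z_n}) :
  (1 < n)%N -> (2 * k <= n)%N -> (l <= k)%N ->
  #|A| = l -> #|T| = k -> #|A :&: T| = j ->
  inner (w_subset C k A) (w_ksubset C k T) = b_coef C n k l j.
Proof.
move=> n_gt1 le_2kn le_lk cA cT cI.
have le_jl : (j <= l)%N by rewrite -cI -cA subset_leq_card ?subsetIl.
have [||| s [<- <-]] := @exists_perm_pair _ (segment (0 : 'Z_n) l)
   (segment ((l - j)%N%:R : 'Z_n) k) A T.
- by rewrite card_segment //; lia.
- by rewrite card_segment //; lia.
- by rewrite segmentI ?card_segment //; lia.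
exact: inner_w_act.
Qed.

(** * Expansion of the product over transversals of the pairs *)

Section Expansion.

Variables n k l : nat.
Variable p : 'I_l * bool -> 'Z_n.
Hypothesis p_inj : injective p.

Definition transversal (J : {set 'I_l}) : {set 'Z_n} :=
  [set p (i, i \in J) | i : 'I_l].

Lemma pair_product_expand (S : ksubset n k) :
  pair_product k p S =
  \sum_(J : {set 'I_l}) (-1) ^+ (l - #|J|) * (transversal J \subset val S)%:R.
Proof.
rewrite ffunE bigA_distr; apply: eq_big => // J _.
rewrite (eq_bigr (fun i =>
    (-1) ^+ (i \notin J) * (p (i, i \in J) \in val S)%:R)); last first.
  by move=> i _; case: ifP; rewrite ?mul1r ?mulN1r.
rewrite big_split /= prodrXr; congr (_ ^+ _ * _).
  transitivity #|~: J|; last by rewrite cardsCs setCK card_ord.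
  rewrite -sum1_card [RHS]big_mkcond; apply: eq_bigr => i _.
  by rewrite inE; case: (i \in J).
have [/subsetP sub|nsub] := boolP (transversal J \subset _).
  by rewrite big1 // => i _; rewrite sub //; apply: imset_f.
have /subsetPn[x /imsetP[i _ ->] /negPf xS] := nsub.
by rewrite (bigD1 i) //= xS mul0r.
Qed.

Lemma card_transversal J : #|transversal J| = l.
Proof.
by rewrite card_imset ?card_ord // => i j /p_inj [].
Qed.

Lemma sum_card_sets (g : nat -> C) :
  \sum_(J : {set 'I_l}) g #|J| = \sum_(0 <= j < l.+1) 'C(l, j)%:R * g j.
Proof.
rewrite (partition_big (fun J : {set 'I_l} => inord #|J| : 'I_l.+1) xpredT) //=.
rewrite big_mkord; apply: eq_bigr => j _.
have -> : 'C(l, j) = #|[set J : {set 'I_l} | #|J| == j]|.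
  by rewrite card_draws card_ord.
rewrite mulr_natl -sumr_const; have lt_J (J : {set 'I_l}) : (#|J| < l.+1)%N.
  by rewrite ltnS -[l in (_ <= l)%N]card_ord max_card.
apply: eq_big => [J|J /eqP <-]; last by rewrite inordK.
by rewrite inE -val_eqE /= inordK.
Qed.

Variable T0 : ksubset n k.
Hypothesis T0_true : forall i, p (i, true) \in val T0.
Hypothesis T0_false : forall i, p (i, false) \notin val T0.

Lemma card_transversalI J : #|transversal J :&: val T0| = #|J|.
Proof.
have inj_t : injective (fun i => p (i, true)) by move=> i j /p_inj [].
rewrite -(card_imset (mem J) inj_t); apply: eq_card => x.
apply/setIP/imsetP => [[/imsetP[i _ ->]]|[i iJ ->]].
  by case iJ: (i \in J); [exists i | rewrite (negPf (T0_false i))].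
by split=> //; apply/imsetP; exists i => //; rewrite iJ.
Qed.

Lemma eigenvalueE : (1 < n)%N -> (2 * k <= n)%N -> (l <= k)%N ->
  Phi_adj (Phi C n k (pair_product k p)) T0 =
  \sum_(J : {set 'I_l}) (-1) ^+ (l - #|J|) * b_coef C n k l #|J|.
Proof.
move=> n_gt1 le_2kn le_lk; rewrite ffunE.
under eq_bigr => F _.
  rewrite PhiE; under eq_bigr do rewrite pair_product_expand.
  rewrite exchange_big; over.
rewrite exchange_big; apply: eq_bigr => J _ /=.
rewrite -(b_coefE (A := transversal J) (T := val T0)) ?card_transversal //;
  [|exact: eqP (valP T0)|exact: card_transversalI].
rewrite inner_w mulr_sumr; apply: eq_bigr => F _.
by rewrite mulr_sumr.
Qed.

End Expansion.

(** * Polytabloids *)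

Lemma reshape_index2 a b c : (c < a + b)%N ->
  reshape_index [:: a; b] c = (a <= c)%N.
Proof.
move=> lt_c; rewrite /reshape_index /= -subnDA !subn_eq0 lt_c ltnNge.
by case: (a <= c)%N.
Qed.

Lemma reshape_offset2 a b c : (c < a + b)%N ->
  reshape_offset [:: a; b] c = (if a <= c then c - a else c)%N.
Proof.
move=> lt_c; rewrite /reshape_offset reshape_index2 //.
by case: ifP => _ /=; rewrite ?addn0 ?subn0.
Qed.

Section Polytabloid.

Variables n l : nat.
Hypothesis n_gt1 : (1 < n)%N.
Hypothesis le_2ln : (2 * l <= n)%N.

Notation mu := [:: n - l; l]%N.

Definition cell (q : 'I_l * bool) : 'Z_n :=
  inZp (if q.2 then val q.1 else (n - l + q.1)%N).

Lemma val_cell q : cell q = (if q.2 then val q.1 else (n - l + q.1)%N) :> nat.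
Proof.
rewrite /= Zp_cast // modn_small //; have := ltn_ord q.1.
by case: q.2; move: (nat_of_ord q.1) => i /=; lia.
Qed.

Lemma cell_inj : injective cell.
Proof.
move=> [i b] [j d] /(congr1 (@nat_of_ord _)); rewrite !val_cell /=.
have := ltn_ord i; have := ltn_ord j; case: b d => [] [] lt_j lt_i ij.
- by rewrite (val_inj ij).
- by exfalso; move: (nat_of_ord i) (nat_of_ord j) ij lt_i lt_j => i' j' /=; lia.
- by exfalso; move: (nat_of_ord i) (nat_of_ord j) ij lt_i lt_j => i' j' /=; lia.
- by congr (_, _); apply: val_inj; apply: addnI ij.
Qed.

Definition column (c : 'Z_n) := reshape_offset mu c.

Lemma columnE (c : 'Z_n) :
  column c = (if n - l <= c then c - (n - l) else c)%N.
Proof. by rewrite /column reshape_offset2 //; have := lt_Zn c n_gt1; lia. Qed.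

Lemma column_cell i : column (cell (i, true)) = column (cell (i, false)).
Proof.
rewrite !columnE !val_cell /= leq_addr addKn.
by have := ltn_ord i; move: (nat_of_ord i) => j; case: ifP => //; lia.
Qed.

(** A cell of the first row with nothing below it is alone in its column. *)
Lemma column_eq_free (c d : 'Z_n) :
  c \notin codom cell -> column d = column c -> d = c.
Proof.
move=> c_free; rewrite !columnE => dc; apply: ord_inj.
have [le_lc lt_c] : (l <= c)%N /\ (c < n - l)%N.
  split; rewrite leqNgt; apply: contra c_free => lt_c; apply/codomP.
    by exists (Ordinal lt_c, true); apply: ord_inj; rewrite val_cell.
  have lt_c' : (c - (n - l) < l)%N by have := lt_Zn c n_gt1; lia.
  by exists (Ordinal lt_c', false); apply: ord_inj; rewrite val_cell /=; lia.
have := lt_Zn d n_gt1; move: dc le_lc lt_c.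
move: (nat_of_ord c) (nat_of_ord d) => c' d'.
by case: (leqP (n - l) c'); case: (leqP (n - l) d'); lia.
Qed.

Variable t : {perm 'Z_n}.

Notation pairs := (fun q => t (cell q)).

Lemma pairs_inj : injective pairs.
Proof. by move=> q r /perm_inj /cell_inj. Qed.

Lemma column_stabP (s : {perm 'Z_n}) :
  reflect (forall x, column ((t^-1)%g (s x)) = column ((t^-1)%g x))
          (s \in column_stab mu t).
Proof.
rewrite inE; apply: (iffP forallP) => [st x | st c]; last first.
  by rewrite -/(column _) st permK.
by have /eqP := st ((t^-1)%g x); rewrite permKV.
Qed.

Lemma tperm_column_stab i :
  tperm (pairs (i, true)) (pairs (i, false)) \in column_stab mu t.
Proof.
apply/column_stabP => x.
by case: tpermP => [->|->|//]; rewrite !permK column_cell.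
Qed.

Lemma column_stab_fix (s : {perm 'Z_n}) x :
  s \in column_stab mu t -> x \notin codom pairs -> s x = x.
Proof.
move=> /column_stabP st xp; apply: (@perm_inj _ t^-1).
apply: column_eq_free (st x); apply: contra xp => /codomP[q xq].
by apply/codomP; exists q; rewrite -xq permKV.
Qed.

Lemma mem_tabloid (r : 'I_(size mu)) x :
  (x \in tabloid mu t r) = (reshape_index mu ((t^-1)%g x) == r).
Proof.
rewrite ffunE; apply/imsetP/idP => [[c]|xr].
  by rewrite inE => cr ->; rewrite permK.
by exists ((t^-1)%g x); rewrite ?inE ?permKV.
Qed.

Lemma row_free x : x \notin codom pairs -> reshape_index mu ((t^-1)%g x) = 0.
Proof.
move=> xp; have lt_n := lt_Zn ((t^-1)%g x) n_gt1.
rewrite reshape_index2; last by lia.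
case: leqP => // le_x; case/negP: xp; apply/codomP.
have lt_x : ((t^-1)%g x - (n - l) < l)%N by lia.
exists (Ordinal lt_x, false); apply: (@perm_inj _ t^-1); rewrite permK.
by apply: ord_inj; rewrite val_cell /=; lia.
Qed.

Lemma row_family_actM (s s' : {perm 'Z_n}) (Q : row_family n mu) :
  row_family_act s' (row_family_act s Q) = row_family_act (s * s') Q.
Proof.
apply/ffunP => r; rewrite !ffunE -imset_comp; apply: eq_imset => x /=.
by rewrite permM.
Qed.

Lemma perm_rep_polytabloid (s : {perm 'Z_n}) :
  perm_rep C (@row_family_act n mu) s (polytabloid C mu t) =
  \sum_(s' in column_stab mu t)
     (-1 : C) ^+ s' *: basis_vec C (row_family_act (s' * s) (tabloid mu t)).
Proof.
rewrite linear_sum; apply: eq_bigr => s' _.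
by rewrite linearZ /= lin_ext_basis row_family_actM.
Qed.

Lemma polytabloid_column_stab (s : {perm 'Z_n}) : s \in column_stab mu t ->
  perm_rep C (@row_family_act n mu) s (polytabloid C mu t) =
  (-1) ^+ s *: polytabloid C mu t.
Proof.
move=> st; rewrite perm_rep_polytabloid /polytabloid scaler_sumr.
rewrite [RHS](reindex_inj (mulIg s)) /=.
apply: eq_big => [s'|s' _].
  have /column_stabP sK := st.
  by apply/column_stabP/column_stabP => s'K x; have := s'K x; rewrite permM sK.
by rewrite scalerA odd_permM (signr_addb _ s' s) mulrCA -expr2 sqrr_sign mulr1.
Qed.

Lemma polytabloid_free x y : x \notin codom pairs -> y \notin codom pairs ->
  perm_rep C (@row_family_act n mu) (tperm x y) (polytabloid C mu t) =
  polytabloid C mu t.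
Proof.
move=> xp yp; rewrite perm_rep_polytabloid; apply: eq_bigr => s st.
congr (_ *: basis_vec C _); have -> : (s * tperm x y = tperm x y * s)%g.
  have := tpermJ x y s; rewrite !column_stab_fix // /conjg => {1}<-.
  by rewrite !mulgA mulgV mul1g.
rewrite -row_family_actM; congr row_family_act.
apply/ffunP => r; rewrite ffunE; apply/setP => z.
rewrite -{1}(tpermK x y z) mem_imset; last exact: perm_inj.
by rewrite !mem_tabloid; case: tpermP => [->|->|//]; rewrite !row_free.
Qed.

(** Only the identity preserves rows and columns, so the tabloid of t has
    coefficient 1. *)
Lemma polytabloid_neq0 : polytabloid C mu t != 0.
Proof.
apply/eqP => /ffunP /(_ (tabloid mu t)); rewrite sum_ffunE ffunE.
rewrite (bigD1 1%g) /=; last by apply/column_stabP => x; rewrite perm1.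
rewrite big1 => [|s /andP[st s1]].
  rewrite addr0 !ffunE odd_perm1 expr0 (_ : row_family_act _ _ = tabloid mu t).
    by rewrite eqxx => /eqP; rewrite /GRing.scale /= mulr1 oner_eq0.
  apply/ffunP => r; rewrite ffunE -[RHS]imset_id.
  by apply: eq_imset => x; rewrite perm1.
rewrite !ffunE (_ : (_ == _) = false); first exact: mulr0.
apply: contra_neqF s1 => /eqP tabE; apply/permP => x; rewrite perm1.
apply: (@perm_inj _ t^-1); apply: ord_inj.
rewrite -[LHS](reshape_indexK mu) -[RHS](reshape_indexK mu).
have /column_stabP /(_ x) := st; rewrite /column => ->; congr flatten_index.
have lt_r : (reshape_index mu ((t^-1)%g x) < size mu)%N.
  have lt_n := lt_Zn ((t^-1)%g x) n_gt1.
  by apply: reshape_indexP; rewrite /= addn0; lia.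
have : s x \in tabloid mu t (Ordinal lt_r).
  by rewrite tabE ffunE imset_f // mem_tabloid.
by rewrite mem_tabloid => /eqP.
Qed.

(** A symmetry s e = a e of the polytabloid e lifts to U, because s u - a u lies
    in U and in the kernel of f. *)
Lemma alternating_preimage k (U : {vspace freemod C (ksubset n k)})
    (f : 'Hom(freemod C (ksubset n k), freemod C (row_family n mu))) u :
  submodule (perm_rep C (@ksubset_act n k)) U ->
  (U :&: lker f)%VS = 0%VS ->
  (forall s v, v \in U -> f (perm_rep C (@ksubset_act n k) s v) =
     perm_rep C (@row_family_act n mu) s (f v)) ->
  u \in U -> f u = polytabloid C mu t -> pair_alternating pairs u.
Proof.
move=> U_sub U_ker f_equiv uU fu.
have symm (s : {perm 'Z_n}) (a : C) :
    perm_rep C (@row_family_act n mu) s (polytabloid C mu t) =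
      a *: polytabloid C mu t ->
    perm_rep C (@ksubset_act n k) s u = a *: u.
  have fau : f (a *: u) = a *: polytabloid C mu t by rewrite linearZ /= fu.
  move=> es; apply/eqP; rewrite -subr_eq0 -memv0 -U_ker memv_cap.
  rewrite memv_ker linearB /= f_equiv // fu es fau subrr eqxx.
  rewrite andbT.
  by rewrite rpredB ?rpredZ //; apply: (subvP (U_sub s)); exact: memv_img.
split=> [i T|x y xp yp T].
  have := symm _ _ (polytabloid_column_stab (tperm_column_stab i)).
  move=> /ffunP /(_ T); rewrite perm_repE tpermV => ->.
  rewrite odd_tperm (inj_eq pairs_inj) xpair_eqE eqxx expr1 ffunE.
  exact: mulN1r.
have := symm (tperm x y) 1; rewrite scale1r => /(_ (polytabloid_free xp yp)).
by move=> /ffunP /(_ T); rewrite perm_repE tpermV scale1r.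
Qed.

(** The first k cells contain the first l cells and stop before the second
    row. *)
Lemma base_ksubset k : (l <= k)%N -> (k <= n - l)%N ->
  exists T0 : ksubset n k, (forall i, pairs (i, true) \in val T0) /\
    (forall i, pairs (i, false) \notin val T0).
Proof.
move=> le_lk le_knl; pose B := [set c : 'Z_n | (c < k)%N].
have cB : #|t @: B| == k.
  rewrite card_imset; last exact: perm_inj.
  have le_kn : (k <= (Zp_trunc n).+2)%N by rewrite Zp_cast //; lia.
  have w_inj : injective (widen_ord le_kn).
    by move=> i j /(congr1 (@nat_of_ord _)) /= /ord_inj.
  rewrite -[X in _ == X]card_ord -(card_imset predT w_inj).
  apply/eqP/eq_card => c; rewrite inE; apply/idP/imsetP => [lt_c|[i _ ->]];
    last exact: (ltn_ord i).
  by exists (Ordinal lt_c) => //; exact: ord_inj.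
exists (Sub (t @: B) cB); split=> i; rewrite SubK mem_imset ?inE ?val_cell /=.
- by apply: leq_trans le_lk; exact: ltn_ord.
- exact: perm_inj.
- by rewrite -leqNgt; apply: leq_trans le_knl (leq_addr _ _).
- exact: perm_inj.
Qed.

End Polytabloid.

(** * Phi does not vanish *)

Section NonVanishing.

Variables n k l : nat.
Hypothesis l_ge2 : (2 <= l)%N.
Hypothesis le_lk : (l <= k)%N.
Hypothesis lt_2kn : (2 * k < n)%N.

(** Positions for the pairs such that the first two pairs, 1 with 0 and k with
    k + 1, lie across the two ends of the interval 1, ..., k, while every other
    pair has one point inside and one outside. *)
Definition end_position (q : 'I_l * bool) : nat :=
  let: (i, b) := q in
  if b then (if i == 0 :> nat then 1 else if i == 1 :> nat then k else i)%N
  else (if i == 0 :> nat then 0 else k + i)%N.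

Definition end_pair (q : 'I_l * bool) : 'Z_n := (end_position q)%:R.

Let n_gt1 : (1 < n)%N. Proof. by lia. Qed.

Lemma end_position_lt q : (end_position q < n)%N.
Proof.
case: q => [[i lt_i] b] /=.
by case: b; case: eqP => ?; try case: eqP => ?; lia.
Qed.

Lemma end_pair_inj : injective end_pair.
Proof.
move=> q q' /(congr1 (@nat_of_ord _)).
rewrite !val_Zp_nat // !modn_small ?end_position_lt //.
case: q q' => [[i lt_i] b] [[j lt_j] d] /= ij.
suff [eij ->] : i = j /\ b = d by congr (_, _); apply: ord_inj.
by move: ij; case: b; case: d; do ?[case: eqP => ?]; split=> //; lia.
Qed.

(** An interval of length k that separates 0 from 1 starts at 1 or ends at 0,
    and one that separates k from k + 1 ends at k or starts at k + 1.  As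
    2k < n, only the interval 1, ..., k does both. *)
Lemma segment_between_ends (c : 'Z_n) :
  ((1%:R : 'Z_n) \in segment c k) != ((0%:R : 'Z_n) \in segment c k) ->
  ((k%:R : 'Z_n) \in segment c k) != (((k + 1)%N%:R : 'Z_n) \in segment c k) ->
  c = 0.
Proof.
have le_kn : (k <= n)%N by lia.
(* With y = - c, each membership compares y minus a natural number with k. *)
have -> : c = - (- c) by rewrite opprK.
move: (- c) => {c} y.
have n0 : n%:R = 0 :> 'Z_n by rewrite pchar_Zp.
rewrite !mem_segment // !opprK.
have -> : 1%:R + y - 1 = y by ring.
have -> : 0%:R + y - 1 = y - 1%:R by ring.
have -> : k%:R + y - 1 = y - (n - k).+1%:R.
  by rewrite -natr1 natrB // n0; ring.
have -> : (k + 1)%N%:R + y - 1 = y - (n - k)%:R.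
  by rewrite natrD natrB // n0; ring.
rewrite !val_ZnB //; try lia.
move=> e1 e2; suff y0 : y = 0 :> nat.
  by apply: oppr_inj; rewrite opprK oppr0; apply: ord_inj.
have := lt_Zn y n_gt1; move: e1 e2; move: (nat_of_ord y) => z.
by case: (leqP 1 z); case: (leqP (n - k).+1 z); case: (leqP (n - k) z); lia.
Qed.

Lemma mem_segment0 x : (x < n)%N ->
  ((x%:R : 'Z_n) \in segment (0 : 'Z_n) k) = (0 < x <= k)%N.
Proof.
move=> lt_xn; rewrite mem_segment //; last by lia.
rewrite subr0 -[_ - 1]/(_ - 1%:R) val_ZnB // val_Zp_nat // modn_small //.
by case: (leqP 1 x); lia.
Qed.

Lemma Phi_end_pair_neq0 : Phi C n k (pair_product k end_pair) != 0.
Proof.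
have le_kn : (k <= n)%N by lia.
have F_wr : wreath_of k (1%g : {perm 'Z_n}) \in wreaths n k by exact: imset_f.
have cI : #|segment (0 : 'Z_n) k| == k by rewrite card_segment.
pose I : ksubset n k := Sub (segment (0 : 'Z_n) k) cI.
have imset_perm1 (B : {set 'Z_n}) : (1%g : {perm 'Z_n}) @: B = B.
  by rewrite -[RHS]imset_id; apply: eq_imset => x; rewrite perm1.
apply/eqP => /ffunP /(_ (Sub (wreath_of k 1) F_wr)).
rewrite PhiE ffunE (bigD1 I) /=; last first.
  by apply/imsetP; exists 1; rewrite // subrr mul0r imset_perm1.
rewrite pair_product_base => [|i|i]; last 2 first.
- rewrite /= mem_segment0 ?end_position_lt //; case: i => i lt_i /=.
  by case: eqP => ?; try case: eqP => ?; lia.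
- rewrite /= mem_segment0 ?end_position_lt //; case: i => i lt_i /=.
  by case: eqP => ?; lia.
rewrite big1 ?addr0; first by move/eqP; rewrite oner_eq0.
move=> T /andP[/imsetP[i _ TE] TI].
pose i0 : 'I_l := Ordinal (ltnW l_ge2); pose i1 : 'I_l := Ordinal l_ge2.
have [e0|ne0] := eqVneq (end_pair (i0, true) \in val T)
                          (end_pair (i0, false) \in val T).
  exact: pair_product_eq0 e0.
have [e1|ne1] := eqVneq (end_pair (i1, true) \in val T)
                          (end_pair (i1, false) \in val T).
  exact: pair_product_eq0 e1.
have {}TE : val T = segment ((i - 1) * k%:R) k by rewrite -[RHS]imset_perm1.
case/eqP: TI; apply: val_inj; rewrite /= TE in ne0 ne1 *.
by rewrite (segment_between_ends ne0 ne1).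
Qed.

End NonVanishing.

(** * The summands of the k-subset module *)

Section Summand.

Variables n k l : nat.
Hypothesis l_ge2 : (2 <= l)%N.
Hypothesis le_lk : (l <= k)%N.
Hypothesis lt_2kn : (2 * k < n)%N.

Notation mu := [:: n - l; l]%N.

Variable U : {vspace freemod C (ksubset n k)}.
Variable f : 'Hom(freemod C (ksubset n k), freemod C (row_family n mu)).
Hypothesis U_sub : submodule (perm_rep C (@ksubset_act n k)) U.
Hypothesis f_img : (f @: U)%VS = Specht C n mu.
Hypothesis U_ker : (U :&: lker f)%VS = 0%VS.
Hypothesis f_equiv : forall s v, v \in U ->
  f (perm_rep C (@ksubset_act n k) s v) =
  perm_rep C (@row_family_act n mu) s (f v).

Let n_gt1 : (1 < n)%N. Proof. by lia. Qed.
Let le_kn : (k <= n)%N. Proof. by lia. Qed.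
Let le_2kn : (2 * k <= n)%N. Proof. by lia. Qed.
Let le_2ln : (2 * l <= n)%N. Proof. by lia. Qed.
Let le_knl : (k <= n - l)%N. Proof. by lia. Qed.

Lemma polytabloid_preimage t :
  exists2 u, u \in U & f u = polytabloid C mu t.
Proof.
have : polytabloid C mu t \in (f @: U)%VS.
  by rewrite f_img; apply: memv_span; apply: map_f; rewrite mem_enum.
by case/memv_imgP => u uU ->; exists u.
Qed.

Lemma wreath_op_Phi_preimage t u :
  u \in U -> f u = polytabloid C mu t ->
  wreath_op C n k (Phi C n k u) =
  (\sum_(0 <= j < l.+1) (-1) ^+ (l - j) * 'C(l, j)%:R * b_coef C n k l j)
    *: Phi C n k u.
Proof.
move=> uU fu.
have [T0 [T0_true T0_false]] := base_ksubset n_gt1 le_2ln t le_lk le_knl.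
have p_inj := @pairs_inj _ _ n_gt1 le_2ln t.
have u_alt := alternating_preimage n_gt1 le_2ln U_sub U_ker f_equiv uU fu.
rewrite (wreath_op_Phi_alternating p_inj T0_true T0_false) //.
rewrite (eigenvalueE p_inj) //.
rewrite (sum_card_sets _ (fun j => (-1) ^+ (l - j) * b_coef C n k l j)).
by congr (_ *: _); apply: eq_bigr => j _; rewrite mulrCA mulrA.
Qed.

(** The eigenvectors in U form a subspace whose image under f contains every
    polytabloid; as f is injective on U, that subspace is U. *)
Lemma wreath_op_Phi_summand v :
  v \in U ->
  wreath_op C n k (Phi C n k v) =
  (\sum_(0 <= j < l.+1) (-1) ^+ (l - j) * 'C(l, j)%:R * b_coef C n k l j)
    *: Phi C n k v.
Proof.
set lam := \sum_(_ <= _ < _) _.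
pose W := lker ((wreath_op C n k \o Phi C n k) - lam *: Phi C n k)%VF.
have memW w :
    (w \in W) = (wreath_op C n k (Phi C n k w) == lam *: Phi C n k w).
  by rewrite memv_ker add_lfunE opp_lfunE scale_lfunE comp_lfunE subr_eq0.
move=> vU; have : f v \in (f @: (U :&: W))%VS.
  have : f v \in Specht C n mu by rewrite -f_img memv_img.
  apply: subvP; apply/span_subvP => e /mapP[t _ ->].
  have [u uU fu] := polytabloid_preimage t.
  rewrite -fu memv_img // memv_cap uU memW.
  exact/eqP/(wreath_op_Phi_preimage uU fu).
case/memv_imgP => w /memv_capP[wU wW] fvw.
suff -> : v = w by apply/eqP; rewrite -memW.
apply/eqP; rewrite -subr_eq0 -memv0 -U_ker memv_cap rpredB // memv_ker.
by rewrite linearB /= fvw subrr.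
Qed.

Lemma Phi_summand_neq0 : exists2 v, v \in U & Phi C n k v != 0.
Proof.
have [t tE] := exists_perm_extending (@cell_inj _ _ n_gt1 le_2ln)
                 (@end_pair_inj n k l l_ge2 le_lk lt_2kn).
have [u uU fu] := polytabloid_preimage t; exists u => //.
have [T0 [T0_true T0_false]] := base_ksubset n_gt1 le_2ln t le_lk le_knl.
have u_neq0 : u != 0.
  apply: contraNneq (polytabloid_neq0 n_gt1 le_2ln t) => u0.
  by rewrite -fu u0 linear0.
have u_alt := alternating_preimage n_gt1 le_2ln U_sub U_ker f_equiv uU fu.
have uE := pair_alternatingE (@pairs_inj _ _ n_gt1 le_2ln t)
             T0_true T0_false u_alt.
rewrite uE in u_neq0 *; move: u_neq0; rewrite !linearZ !scaler_eq0 !negb_or.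
case/andP => -> _ /=.
rewrite (_ : pair_product _ _ = pair_product k (@end_pair n k l)).
  exact: Phi_end_pair_neq0.
by apply/ffunP => T; rewrite !ffunE; apply: eq_bigr => i _; rewrite !tE.
Qed.

End Summand.

End Eigenvalue.

Theorem lemma4p2 (R : realType) (n k l : nat)
  (k_gt0 : (0 < k)%N) (k_lt : (2 * k < n)%N) (l_ge2 : (2 <= l)%N)
  (l_le : (l <= k)%N)
  (U : nat -> {vspace freemod R[i] (ksubset n k)})
  (hU : Specht_decomposition U) :
  lambda U l =
    \sum_(0 <= j < l.+1) (-1) ^+ (l - j) * 'C(l, j)%:R * b_coef R[i] n k l j.
Proof.
case: hU => _ _ /(_ l l_le)[U_sub [f [f_img U_ker f_equiv]]].
have eig := wreath_op_Phi_summand l_ge2 l_le k_lt U_sub f_img U_ker f_equiv.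
have [v vU v_neq0] :=
  Phi_summand_neq0 l_ge2 l_le k_lt U_sub f_img U_ker f_equiv.
set lam := \sum_(_ <= _ < _) _ in eig *.
have scalarE c :
    (forall w, w \in (Phi R[i] n k @: U l)%VS -> wreath_op _ n k w = c *: w) ->
    c = lam.
  move=> /(_ _ (memv_img _ vU)); rewrite eig // => /eqP.
  rewrite -subr_eq0 -scalerBl scaler_eq0 (negPf v_neq0) orbF subr_eq0.
  by move/eqP.
apply: classical_sets.xget_subset1 => [_ /memv_imgP[w wU ->]|c d].
  exact: eig.
by move=> /scalarE -> /scalarE ->.
Qed.
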